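(* Let $n\ge 2$, let $A\in\mathbb{R}^{n\times n}$ be a symmetric matrix with pairwise different eigenvalues $\lambda_1<\lambda_2<\dots<\lambda_n$, let $f(x)=(Ax,x)$ and let $S=\{x\in\mathbb{R}^n:\|x\|=1\}$ be the unit sphere. Then the problem $\min_{x\in S}f(x)$ satisfies the tangent Error Bound condition with constant $\mu=\min_{i\ne j}|\lambda_i-\lambda_j|$, i.e. $$\mu\,\rho(x,\Omega)\le\|P_{T_x}f'(x)\|\qquad\text{for all }x\in S.$$
   Context: $(\cdot,\cdot)$ and $\|\cdot\|$ are the Euclidean inner product and norm on $\mathbb{R}^n$; $f'$ is the gradient of $f$; $T_x=\{v\in\mathbb{R}^n:(x,v)=0\}$ is the tangent subspace to the sphere at $x\in S$ and $P_{T_x}$ is the orthogonal projector onto $T_x$; $\Omega=\{x\in S: P_{T_x}f'(x)=0\}$ is the set of stationary points; $\rho(x,\Omega)=\inf_{y\in\Omega}\|x-y\|$. *)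

(* Defs.v *)
From mathcomp Require Import all_boot all_order all_algebra.
From mathcomp Require Import all_classical all_reals all_analysis.

Set Implicit Arguments.
Unset Strict Implicit.
Unset Printing Implicit Defensive.

Import Order.TTheory GRing.Theory Num.Theory.
Import numFieldNormedType.Exports.

Local Open Scope classical_set_scope.
Local Open Scope ring_scope.

Definition dot (R : realType) (n : nat) (x y : 'cV[R]_n) : R :=
  \sum_(i < n) x i 0 * y i 0.

(* The norm [`|x|] of the library is the sup norm on ['cV[R]_n], hence this
   separate definition. *)
Definition enorm (R : realType) (n : nat) (x : 'cV[R]_n) : R :=
  Num.sqrt (dot x x).

Definition sphere (R : realType) (n : nat) : set 'cV[R]_n :=
  [set x | enorm x = 1].

(* The vector of partial derivatives. *)
Definition gradient (R : realType) (n : nat) (f : 'cV[R]_n -> R)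
    (x : 'cV[R]_n) : 'cV[R]_n :=
  \col_(i < n) 'D_(delta_mx i 0) f x.

Definition tangent (R : realType) (n : nat) (x : 'cV[R]_n) : set 'cV[R]_n :=
  [set v | dot x v = 0].

(* The point [p] of the subspace [V] with [v - p] orthogonal to [V]; in finite
   dimension it exists and is unique, so that the default value [0] of [xget]
   is never used. *)
Definition orth_proj (R : realType) (n : nat) (V : set 'cV[R]_n)
    (v : 'cV[R]_n) : 'cV[R]_n :=
  xget 0 [set p | V p /\ forall w, V w -> dot (v - p) w = 0].

Definition tangent_gradient (R : realType) (n : nat) (f : 'cV[R]_n -> R)
    (x : 'cV[R]_n) : 'cV[R]_n :=
  orth_proj (tangent x) (gradient f x).

Definition stationary (R : realType) (n : nat) (f : 'cV[R]_n -> R) :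
    set 'cV[R]_n :=
  [set x | sphere x /\ tangent_gradient f x = 0].

(* [inf] is [0] on the empty set; this value is meaningful for nonempty [Y] only,
   in particular for the stationary points of a quadratic form on the sphere. *)
Definition edist (R : realType) (n : nat) (x : 'cV[R]_n) (Y : set 'cV[R]_n) :
    R :=
  inf [set enorm (x - y) | y in Y].

(* The tangent Error Bound condition for the minimization of [f] over the unit
   sphere. *)
Definition tangent_error_bound (R : realType) (n : nat) (f : 'cV[R]_n -> R)
    (mu : R) : Prop :=
  forall x, sphere x ->
    mu * edist x (stationary f) <= enorm (tangent_gradient f x).

Definition quad_form (R : realType) (n : nat) (A : 'M[R]_n) (x : 'cV[R]_n) :
    R :=
  dot (A *m x) x.

(* For [2 <= n] this set is finite and nonempty, so that its infimum is a
   minimum (see [min_gap_attained]). *)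
Definition min_gap (R : realType) (n : nat) (lam : 'I_n -> R) : R :=
  inf [set `|lam ij.1 - lam ij.2| | ij in [set ij : 'I_n * 'I_n | ij.1 != ij.2]].

Lemma min_gap_attained (R : realType) (n : nat) (lam : 'I_n -> R) :
  (2 <= n)%N ->
  (exists i j, i != j /\ min_gap lam = `|lam i - lam j|) /\
  (forall i j, i != j -> min_gap lam <= `|lam i - lam j|).
Proof.
move=> n2; pose d (p : 'I_n * 'I_n) := `|lam p.1 - lam p.2|.
pose p0 := (Ordinal (ltnW n2), Ordinal n2).
case: (@arg_minP _ _ _ p0 (fun p => p.1 != p.2) d isT) => [[i j] /= ij dmin].
have gapE : min_gap lam = `|lam i - lam j|.
  apply/eqP; rewrite eq_le; apply/andP; split.
    by apply: ge_inf; [exists 0 => _ [p _ <-] | exists (i, j)].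
  by apply: lb_le_inf; [exists (d (i, j)), (i, j) | move=> _ [p pp <-]; exact: dmin].
split; first by exists i, j.
by move=> k l kl; rewrite gapE; exact: (dmin (k, l)).
Qed.

(* Main.v *)
(** In an orthonormal eigenbasis [e_i] of [A], let [x] have the coordinates
    [c_i] and put [w_i = c_i^2], so that the [w_i] are the weights of a
    probability measure on the spectrum, with mean [a = f x] and variance [V].
    As [f' x = 2 A x], one has [||P_{T_x} f' x||^2 = 4 ||A x - a x||^2 = 4 V].
    Writing [2 V] as the sum of the [w_i w_j (lam_i - lam_j)^2] gives
    [2 V >= mu^2 (1 - w_k)], where [w_k] is the largest weight.  Both [e_k] and
    [- e_k] are stationary, and with the sign of [c_k] one of them is at squared
    distance [2 - 2 |c_k| <= 2 (1 - w_k)] from [x]. *)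

Require Import Defs.
From mathcomp Require Import all_boot all_order all_algebra.
From mathcomp Require Import all_classical all_reals all_analysis.
From mathcomp Require Import ring lra.

Set Implicit Arguments.
Unset Strict Implicit.
Unset Printing Implicit Defensive.

Import Order.TTheory GRing.Theory Num.Theory.
Import numFieldNormedType.Exports.

Local Open Scope classical_set_scope.
Local Open Scope ring_scope.

Section Dot.
Context {R : realType} {n : nat}.
Implicit Types (x y z v p : 'cV[R]_n) (A : 'M[R]_n).

Lemma dotE x y : dot x y = (x^T *m y) 0 0.
Proof. by rewrite mxE; apply: eq_bigr => i _; rewrite mxE. Qed.

Lemma dotC x y : dot x y = dot y x.
Proof. by apply: eq_bigr => i _; rewrite mulrC. Qed.

Lemma dotDl x y z : dot (x + y) z = dot x z + dot y z.
Proof. by rewrite !dotE linearD mulmxDl mxE. Qed.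

Lemma dotZl (a : R) x z : dot (a *: x) z = a * dot x z.
Proof. by rewrite !dotE linearZ -scalemxAl mxE. Qed.

Lemma dotBl x y z : dot (x - y) z = dot x z - dot y z.
Proof. by rewrite -scaleN1r dotDl dotZl mulN1r. Qed.

Lemma dotDr x y z : dot z (x + y) = dot z x + dot z y.
Proof. by rewrite dotC dotDl !(dotC z). Qed.

Lemma dotZr (a : R) x z : dot z (a *: x) = a * dot z x.
Proof. by rewrite dotC dotZl (dotC z). Qed.

Lemma dotBr x y z : dot z (x - y) = dot z x - dot z y.
Proof. by rewrite dotC dotBl !(dotC z). Qed.

Lemma dot_ge0 x : 0 <= dot x x.
Proof. by apply: sumr_ge0 => i _; rewrite -expr2 sqr_ge0. Qed.

Lemma dot_eq0 x : dot x x = 0 -> x = 0.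
Proof.
move=> /eqP; rewrite psumr_eq0 => [/allP x0|i _]; last first.
  by rewrite -expr2 sqr_ge0.
apply/colP => i; rewrite mxE; apply/eqP.
by have := x0 i (mem_index_enum _); rewrite -expr2 sqrf_eq0.
Qed.

Lemma dot_mulmxl A x y : dot (A *m x) y = dot x (A^T *m y).
Proof. by rewrite !dotE trmx_mul mulmxA. Qed.

Lemma enorm_ge0 x : 0 <= enorm x.
Proof. exact: sqrtr_ge0. Qed.

Lemma enorm_sqr x : enorm x ^+ 2 = dot x x.
Proof. by rewrite sqr_sqrtr// dot_ge0. Qed.

Lemma sphereP x : sphere x <-> dot x x = 1.
Proof.
rewrite /sphere /= -enorm_sqr; split => [->|h]; first by rewrite expr1n.
by apply/eqP; rewrite -sqrp_eq1 ?enorm_ge0// h.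
Qed.

(** If [q] is another candidate, [q - p = (v - p) - (v - q)] lies in [V] and is orthogonal to [V],
    hence to itself. *)
Lemma orth_proj_unique (V : set 'cV[R]_n) v p :
    (forall u w, V u -> V w -> V (u - w)) ->
    V p -> (forall w, V w -> dot (v - p) w = 0) -> orth_proj V v = p.
Proof.
move=> VB Vp vp; apply: xget_unique => // q [Vq vq].
apply/eqP; rewrite -subr_eq0; apply/eqP/dot_eq0.
have Vd := VB _ _ Vq Vp.
by rewrite -[q in dot (q - p)](subKr v) addrAC dotBl vp// vq// subrr.
Qed.

Lemma orth_proj_tangent x v :
  sphere x -> orth_proj (tangent x) v = v - dot v x *: x.
Proof.
move=> /sphereP x1; apply: orth_proj_unique => [u w||w] /=; rewrite /tangent /=.
- by move=> xu xw; rewrite dotBr xu xw subrr.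
- by rewrite dotBr dotZr x1 mulr1 dotC subrr.
- by move=> xw; rewrite subKr dotZl xw mulr0.
Qed.

(** By symmetry the two cross terms of the expansion agree, so the difference quotient along [e] is
    affine in [h], with slope [dot (A *m e) e]. *)
Lemma gradient_quad_form A x :
  A^T = A -> gradient (quad_form A) x = 2 *: (A *m x).
Proof.
move=> As; apply/colP => i; rewrite !mxE -[RHS]/(2 * _).
set e := delta_mx i 0.
have -> : \sum_j A i j * x j 0 = dot (A *m x) e.
  rewrite /dot [RHS](bigD1 i)//= [X in _ + X]big1 ?addr0 => [|j /negPf ji].
    by rewrite !mxE !eqxx mulr1.
  by rewrite [e _ _]mxE ji mulr0.
apply: cvg_lim => //.
have quot : \forall h \near (0 : R)^',
    2 * dot (A *m x) e + h * dot (A *m e) e =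
    h^-1 *: (quad_form A (h *: e + x) - quad_form A x).
  near=> h.
  have h0 : h != 0 by near: h; exact: nbhs_dnbhs_neq.
  rewrite /quad_form mulmxDr -scalemxAr !(dotDl, dotDr, dotZl, dotZr).
  rewrite (_ : dot (A *m e) x = dot (A *m x) e); last first.
    by rewrite dot_mulmxl As dotC.
  by rewrite -[RHS]/(_ * _); field.
apply: cvg_trans; first exact: (near_eq_cvg quot).
(* The limit is recast as a sum whose second term is [0 * dot (A *m e) e], to match the affine
   quotient term by term. *)
rewrite -[Y in _ `=>` nbhs Y]addr0 -[Y in nbhs (_ + Y)](mul0r (dot (A *m e) e)).
apply: cvgD; first exact: cvg_cst.
by apply: cvgMl; exact: nbhs_dnbhs.
Unshelve. all: by end_near.
Qed.

Lemma tangent_gradient_quad_form A x : A^T = A -> sphere x ->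
  tangent_gradient (quad_form A) x = 2 *: (A *m x - quad_form A x *: x).
Proof.
move=> As x1; rewrite /tangent_gradient orth_proj_tangent// gradient_quad_form//.
by rewrite dotZl scalerBr scalerA.
Qed.

Lemma eigenvector_stationary A (a : R) x :
  A^T = A -> sphere x -> A *m x = a *: x -> stationary (quad_form A) x.
Proof.
move=> As x1 Ax; split=> //; rewrite tangent_gradient_quad_form//.
by rewrite /quad_form Ax dotZl (sphereP x).1// mulr1 subrr scaler0.
Qed.

Lemma edist_le x y (Y : set 'cV[R]_n) : Y y -> Defs.edist x Y <= enorm (x - y).
Proof.
move=> Yy; apply: ge_inf; last by exists y.
by exists 0 => _ [z _ <-]; exact: enorm_ge0.
Qed.

(** Moving [A] across the product gives [lam i * dot (e i) (e j) = lam j * dot (e i) (e j)], so unit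
    eigenvectors of distinct eigenvalues are orthogonal. *)
Lemma orthonormal_eigenbasis A (lam : 'I_n -> R) :
    A^T = A -> injective lam -> (forall i, eigenvalue A (lam i)) ->
  exists e : 'I_n -> 'cV[R]_n,
    (forall i, A *m e i = lam i *: e i) /\
    (forall i j, dot (e i) (e j) = (i == j)%:R).
Proof.
move=> As lamI lamE.
have unit_eigenvector i : exists v, A *m v = lam i *: v /\ dot v v = 1.
  (* [eigenvalueP] yields a row eigenvector; symmetry of [A] turns its transpose into a column
     one. *)
  have /eigenvalueP[u uA u0] := lamE i.
  have uu0 : enorm u^T != 0.
    apply: contra_neq u0 => uu; apply: trmx_inj; rewrite trmx0.
    by apply: dot_eq0; rewrite -enorm_sqr uu expr0n.
  exists ((enorm u^T)^-1 *: u^T); split.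
    by rewrite -scalemxAr -{1}As -trmx_mul uA linearZ/= !scalerA mulrC.
  by rewrite dotZl dotZr -enorm_sqr; field.
have [e eP] := choice unit_eigenvector.
exists e; split=> [i|i j]; first by case: (eP i).
have [Aei eii] := eP i; have [Aej _] := eP j.
case: (eqVneq i j) => [<-//|ij].
have /eqP : lam i * dot (e i) (e j) = lam j * dot (e i) (e j).
  by rewrite -dotZl -Aei dot_mulmxl As Aej dotZr.
rewrite -subr_eq0 -mulrBl mulf_eq0 subr_eq0 => /orP[/eqP/lamI/eqP|/eqP//].
by rewrite (negPf ij).
Qed.

Lemma parseval (e : 'I_n -> 'cV[R]_n) x y :
    (forall i j, dot (e i) (e j) = (i == j)%:R) ->
  dot x y = \sum_i dot (e i) x * dot (e i) y.
Proof.
move=> eO; pose P := \matrix_(i, j) e i j 0.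
have PE z i : (P *m z) i 0 = dot (e i) z.
  by rewrite mxE; apply: eq_bigr => j _; rewrite mxE.
have PPt : P *m P^T = 1%:M.
  apply/matrixP => i j; rewrite !mxE -eO.
  by apply: eq_bigr => k _; rewrite !mxE.
(* [P] is square, so its right inverse [P^T] is also a left inverse. *)
rewrite -[y in LHS]mul1mx -(mulmx1C PPt) -mulmxA.
rewrite -{1}(trmxK P) -dot_mulmxl trmxK.
by apply: eq_bigr => i _; rewrite !PE.
Qed.

End Dot.

(** The second moment about [lam i] is the variance plus [(lam i - a) ^+ 2]; its average over [i]
    with weights [w] is twice the variance. *)
Lemma variance_gap (R : realType) (n : nat) (w lam : 'I_n -> R) (mu M a : R) :
    (forall i, 0 <= w i) -> \sum_i w i = 1 -> a = \sum_i w i * lam i ->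
    0 <= mu -> (forall i j, i != j -> mu <= `|lam i - lam j|) ->
    (forall i, w i <= M) ->
  mu ^+ 2 * (1 - M) <= 2 * \sum_i w i * (lam i - a) ^+ 2.
Proof.
move=> w0 w1 aE mu0 gap wM.
set V := \sum_i w i * (lam i - a) ^+ 2.
have centered : \sum_i w i * (lam i - a) = 0.
  under eq_bigr do rewrite mulrBr.
  by rewrite sumrB -aE -mulr_suml w1 mul1r subrr.
have moment i : \sum_j w j * (lam i - lam j) ^+ 2 = V + (lam i - a) ^+ 2.
  have -> : \sum_j w j * (lam i - lam j) ^+ 2 =
      \sum_j (w j * (lam j - a) ^+ 2 +
        (w j * (lam i - a) ^+ 2 + w j * (lam j - a) * (- 2 * (lam i - a)))).
    by apply: eq_bigr => j _; ring.
  by rewrite !big_split /= -!mulr_suml w1 centered mul1r mul0r addr0.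
(* The term [j = i] vanishes; the others carry total weight [1 - w i], at least [1 - M]. *)
have momentlb i : mu ^+ 2 * (1 - M) <= V + (lam i - a) ^+ 2.
  rewrite -moment (bigD1 i)//= subrr expr0n mulr0 add0r.
  apply: (@le_trans _ _ (\sum_(j | j != i) mu ^+ 2 * w j)).
    rewrite -mulr_sumr ler_wpM2l ?sqr_ge0//.
    by rewrite -w1 (bigD1 i)//=; have := wM i; lra.
  apply: ler_sum => j ji; rewrite mulrC ler_wpM2l//.
  rewrite -(real_normK (num_real (lam i - lam j))) ler_pXn2r ?nnegrE//.
  by rewrite gap// eq_sym.
rewrite -[leLHS]mul1r -[Y in Y * _ <= _]w1 mulr_suml.
have -> : 2 * V = \sum_i w i * (V + (lam i - a) ^+ 2).
  under eq_bigr do rewrite mulrDr.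
  by rewrite big_split/= -mulr_suml w1 mul1r mulr2n mulrDl mul1r.
by apply: ler_sum => i _; rewrite ler_wpM2l.
Qed.

Theorem lemma2 (R : realType) (n : nat) (A : 'M[R]_n) (lam : 'I_n -> R)
    (n_ge2 : (2 <= n)%N)
    (A_sym : A^T = A)
    (lam_incr : forall i j : 'I_n, (i < j)%N -> lam i < lam j)
    (lam_eigen : forall a : R, eigenvalue A a <-> exists i : 'I_n, a = lam i) :
  tangent_error_bound (quad_form A) (min_gap lam).
Proof.
move=> x x1; have xx := (sphereP x).1 x1.
have [[i0 [j0 [_ muE]]] gap] := min_gap_attained lam n_ge2.
have mu0 : 0 <= min_gap lam by rewrite muE.
have lamI : injective lam.
  move=> i j lij; apply: val_inj.
  by case: (ltngtP i j) => // /lam_incr; rewrite lij ltxx.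
have [e [Ae eO]] : exists e : 'I_n -> 'cV[R]_n,
    (forall i, A *m e i = lam i *: e i) /\
    (forall i j, dot (e i) (e j) = (i == j)%:R).
  by apply: orthonormal_eigenbasis => // i; apply/lam_eigen; exists i.
pose c i := dot (e i) x; pose a := quad_form A x.
have dotAx i : dot (e i) (A *m x) = lam i * c i.
  by rewrite dotC dot_mulmxl A_sym Ae dotZr dotC.
have c1 : \sum_i c i ^+ 2 = 1 by rewrite -xx (parseval _ _ eO).
have aE : a = \sum_i c i ^+ 2 * lam i.
  rewrite /a /quad_form (parseval _ _ eO); apply: eq_bigr => i _.
  by rewrite dotAx -/(c i); ring.
have VE : dot (A *m x - a *: x) (A *m x - a *: x) =
    \sum_i c i ^+ 2 * (lam i - a) ^+ 2.
  rewrite (parseval _ _ eO); apply: eq_bigr => i _.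
  by rewrite dotBr dotZr dotAx -/(c i); ring.
have [k _ kmax] := @arg_maxP _ _ _ i0 predT (fun i => c i ^+ 2) isT.
have V_ge := variance_gap (fun i => sqr_ge0 (c i)) c1 aE mu0 gap
  (fun i => kmax i isT).
have ck1 : `|c k| <= 1.
  rewrite -(@ler_pXn2r _ 2)// ?nnegrE// expr1n real_normK ?num_real//.
  rewrite -c1 (bigD1 k)//= lerDl.
  by apply: sumr_ge0 => i _; exact: sqr_ge0.
(* This sign selects the one of [e k] and [- e k] on the same side as [x]. *)
pose s : R := (-1) ^+ (c k < 0)%R.
have ss : s * s = 1 by rewrite -expr2 sqrr_sign.
have sck : s * c k = `|c k| by rewrite normrEsign.
have sqdist : dot (x - s *: e k) (x - s *: e k) = 2 - 2 * `|c k|.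
  rewrite !(dotBl, dotBr, dotZl, dotZr) eO eqxx xx (dotC x) -/(c k) sck.
  by rewrite mulr1 mulrBr sck ss; ring.
have stat : stationary (quad_form A) (s *: e k).
  apply: (@eigenvector_stationary _ _ _ (lam k)) => //.
    by apply/sphereP; rewrite dotZl dotZr eO eqxx mulr1.
  by rewrite -scalemxAr Ae !scalerA mulrC.
have dist := edist_le x stat.
(* The distance to [s *: e k] bounds the infimum from above; both sides being nonnegative, squares
   are then compared. *)
apply: (le_trans (ler_wpM2l mu0 dist)).
rewrite -(@ler_pXn2r _ 2)// ?nnegrE ?mulr_ge0 ?enorm_ge0//.
rewrite exprMn !enorm_sqr tangent_gradient_quad_form// sqdist -/a.
rewrite dotZl dotZr VE.
apply: (@le_trans _ _ (2 * (min_gap lam ^+ 2 * (1 - c k ^+ 2)))); last by lra.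
rewrite mulrCA ler_wpM2l ?sqr_ge0//.
(* With [t = |c k|] in [[0, 1]], the claim is [2 - 2 t <= 2 (1 - t^2)], that is [t^2 <= t]. *)
have := normr_ge0 (c k); rewrite -(real_normK (num_real (c k))); nra.
Qed.
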